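(* (i) Let $k\geq 3$ be an integer. There are no integers $n,m,t$ with $2\leq m<n=t+2$ and $F_n^{(k)}+F_m^{(k)}=2^t$ such that either $(n,m)\in[2,k+1]^2$ or $(n,m)\in[k+2,2k+2]^2$. (ii) For every integer $s\geq 1$ and every integer $k\geq 2$ with $k\geq 2^s+s-2$, the quadruple $(n,m,t,k)=(2^s+k,\,2^s+s-1,\,2^s+k-2,\,k)$ satisfies $F_n^{(k)}+F_m^{(k)}=2^t$, with $2\leq m\leq k+1$, $k+2\leq n\leq 2k+2$, and $n=t+2$.
   Context: For an integer $k\geq 2$, the $k$-generalized Fibonacci sequence $(F_n^{(k)})_{n\geq -(k-2)}$ is defined by $F_{-(k-2)}^{(k)}=\cdots=F_0^{(k)}=0$, $F_1^{(k)}=1$, and $F_{n+k}^{(k)}=F_{n+k-1}^{(k)}+\cdots+F_n^{(k)}$ for all $n\geq -(k-2)$. For integers $a<b$, $[a,b]$ denotes $\{a,a+1,\ldots,b\}$. *)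

(* Defs.v *)
From mathcomp Require Import all_boot all_order all_algebra.
From mathcomp Require Import zify.

Set Implicit Arguments.
Unset Strict Implicit.
Unset Printing Implicit Defensive.

Import Order.TTheory GRing.Theory Num.Theory.
Local Open Scope ring_scope.

(* The k consecutive terms F_{j-(k-2)}, ..., F_{j+1} of the k-generalized
   Fibonacci sequence, so that j = 0 gives the initial values 0, ..., 0, 1. *)
Fixpoint gfib_window (k j : nat) : seq nat :=
  if j is i.+1 then
    let w := gfib_window k i in rcons (behead w) (sumn w)
  else rcons (nseq k.-1 0%N) 1%N.

(* F_n^(k), for n >= -(k-2); the value is 0 by convention for smaller n.
   [gfib_init0], [gfib1] and [gfib_rec] below are the defining equations. *)
Definition gfib (k : nat) (n : int) : int :=
  if n + k%:Z - 2 is Posz j then (head 0%N (gfib_window k j))%:Z else 0.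

Lemma size_gfib_window k j : (0 < k)%N -> size (gfib_window k j) = k.
Proof.
move=> k0; elim: j => [|j IH] /=.
  by rewrite size_rcons size_nseq prednK.
by rewrite size_rcons size_behead IH prednK.
Qed.

Lemma nth_gfib_window k j i : (i < k)%N ->
  nth 0%N (gfib_window k j) i = head 0%N (gfib_window k (j + i)).
Proof.
move=> ik; have k0 : (0 < k)%N by apply: leq_ltn_trans ik.
elim: i j ik => [|i IH] j ik; first by rewrite addn0 nth0.
rewrite addnS -addSn -IH; last exact: ltnW.
rewrite /= nth_rcons size_behead size_gfib_window // nth_behead.
by rewrite -ltnS prednK // ik.
Qed.

Lemma gfibE (k j : nat) :
  gfib k (j%:Z - k%:Z + 2) = (head 0%N (gfib_window k j))%:Z.
Proof. by rewrite /gfib; have -> : j%:Z - k%:Z + 2 + k%:Z - 2 = j by lia. Qed.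

Lemma gfib_init0 (k : nat) (n : int) :
  (2 <= k)%N -> - (k%:Z - 2) <= n <= 0 -> gfib k n = 0.
Proof.
move=> k2 /andP[n1 n0].
have [j Dj] : exists j : nat, n = j%:Z - k%:Z + 2.
  by exists `|(n + k%:Z - 2)%R|%N; lia.
have jk : (j < k.-1)%N by lia.
have k0 : (0 < k)%N by apply: ltnW.
rewrite Dj gfibE -[j]add0n -nth_gfib_window /=; last first.
  exact: leq_trans jk (leq_pred k).
by rewrite nth_rcons size_nseq jk nth_nseq jk.
Qed.

Lemma gfib1 (k : nat) : (2 <= k)%N -> gfib k 1 = 1.
Proof.
case: k => [|[|k]] // _.
have e : (k.+1)%:Z - (k.+2)%:Z + 2 = 1 by lia.
rewrite -[X in gfib _ X]e gfibE -[k.+1]add0n -nth_gfib_window //.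
by rewrite nth_rcons size_nseq ltnn eqxx.
Qed.

Lemma gfib_rec (k : nat) (n : int) : (2 <= k)%N -> - (k%:Z - 2) <= n ->
  gfib k (n + k%:Z) = \sum_(i < k) gfib k (n + i%:Z).
Proof.
move=> k2 n1; have k0 : (0 < k)%N by apply: ltnW.
have [j ->] : exists j : nat, n = j%:Z - k%:Z + 2.
  by exists `|(n + k%:Z - 2)%R|%N; lia.
have D i : j%:Z - k%:Z + 2 + i%:Z = (j + i)%N%:Z - k%:Z + 2.
  by lia.
rewrite D gfibE.
under eq_bigr => i _ do rewrite D gfibE -nth_gfib_window //.
rewrite -[in LHS](prednK k0) addnS -addSn -nth_gfib_window ?prednK //=.
rewrite nth_rcons size_behead size_gfib_window // ltnn eqxx.
rewrite sumnE (big_nth 0%N) size_gfib_window // big_mkord.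
exact: (big_morph Posz PoszD).
Qed.

(* Main.v *)
Require Import Defs.
From mathcomp Require Import all_boot all_order all_algebra.
From mathcomp Require Import zify ring.

Import Order.TTheory GRing.Theory Num.Theory.
Local Open Scope ring_scope.

(** On [2, k+1] the sequence is F_n = 2^(n-2), and on [k+2, 2k+2] it is
    F_n = 2^(n-2) - (n-k) 2^(n-k-3); part (ii) is then a substitution.  In
    part (i), two indices in the first range give F_n = 2^t already, while in
    the second range, with a = m - k and d = n - m, the equation becomes
    a + (a+d) 2^d = 2^(k+1).  Hence 2^d divides a, say a = c 2^d, and
    a + c + d = 2^(k+1-d) >= 2^(a-1), which forces a <= 4 and then k = 2. *)

Lemma gfib2 (k : nat) : (2 <= k)%N -> gfib k 2 = 1.
Proof.
case: k => [//|k] k2; have := @gfib_rec k.+1 (2 - k.+1%:Z) k2.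
have -> : 2 - k.+1%:Z + k.+1%:Z = 2 by lia.
rewrite big_ord_recr /= => ->; last by lia.
have -> : 2 - k.+1%:Z + k%:Z = 1 by lia.
rewrite gfib1 // big1 ?add0r // => i _.
by apply: gfib_init0 => //; have := ltn_ord i; lia.
Qed.

(** The sums defining F_(n+1) and F_n share all terms but two: the first gains F_n and loses
    F_(n-k). *)
Lemma gfib_double (k : nat) (n : int) : (2 <= k)%N -> 2 <= n ->
  gfib k (n + 1) = 2 * gfib k n - gfib k (n - k%:Z).
Proof.
case: k => [//|k] k2 n2.
have := @gfib_rec k.+1 (n - k.+1%:Z) k2; rewrite subrK big_ord_recl addr0.
have := @gfib_rec k.+1 (n + 1 - k.+1%:Z) k2; rewrite subrK big_ord_recr /=.
have -> : n + 1 - k.+1%:Z + k%:Z = n by lia.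
move=> ->; last by lia.
move=> Fn; have {}Fn := Fn ltac:(lia).
under eq_bigr => i _.
  have -> : n + 1 - k.+1%:Z + i%:Z = n - k.+1%:Z + (lift ord0 i)%:Z.
    by rewrite lift0; lia.
  over.
by rewrite [in 2 * _]Fn [in X in _ + X = _]Fn; ring.
Qed.

(** In this range the term subtracted in [gfib_double] is one of the initial zeros, so each step is
    a pure doubling. *)
Lemma gfib_first (k i : nat) : (2 <= k)%N -> (i < k)%N ->
  gfib k (i%:Z + 2) = 2 ^+ i.
Proof.
move=> k2; elim: i => [|i IH] ik; first by rewrite gfib2.
have -> : i.+1%:Z + 2 = i%:Z + 2 + 1 by lia.
rewrite gfib_double ?IH ?gfib_init0 ?exprS ?subr0 //; lia.
Qed.

(* Doubled, so that the exponent n - k - 3 = i - 1 stays natural at i = 0. *)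
Lemma gfib_second (k i : nat) : (2 <= k)%N -> (i <= k)%N ->
  2 * gfib k (k%:Z + 2 + i%:Z) = 2 ^+ (k + i).+1 - (i%:Z + 2) * 2 ^+ i.
Proof.
move=> k2; elim: i => [|i IH] ik.
  have -> : k%:Z + 2 + 0%:Z = (k.-1)%:Z + 2 + 1 by lia.
  rewrite gfib_double ?gfib_first //; try lia.
  (* The subtracted term is now F_1 = 1: the first departure from powers of 2. *)
  have -> : (k.-1)%:Z + 2 - k%:Z = 1 by lia.
  by rewrite gfib1 // -exprS prednK ?addn0 ?exprS ?expr0; lia.
have -> : k%:Z + 2 + i.+1%:Z = k%:Z + 2 + i%:Z + 1 by lia.
rewrite gfib_double //; last by lia.
have -> : k%:Z + 2 + i%:Z - k%:Z = i%:Z + 2 by lia.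
rewrite gfib_first // mulrBr IH; last by lia.
by rewrite addnS !exprS -natr1; ring.
Qed.

Lemma expn_pred_le_double (a : nat) : (2 ^ a.-1 <= a.*2 -> a <= 4)%N.
Proof.
suff H b : (b.+4.+1.*2 < 2 ^ b.+4)%N.
  by case: a => [|[|[|[|[|b]]]]] //; rewrite leqNgt H.
by elim: b => [//|b IH]; rewrite expnS; lia.
Qed.

Lemma pow2_eq_add_mul (k a d : nat) : (0 < d)%N -> (1 < a)%N ->
  (a + d <= k + 2)%N -> (a + (a + d) * 2 ^ d = 2 ^ k.+1)%N -> k = 2.
Proof.
move=> d0 a1 adk E.
have dk : (d <= k.+1)%N by lia.
have /dvdnP[c Dc] : (2 ^ d %| a)%N.
  by rewrite -(dvdn_addl _ (dvdn_mull (a + d) (dvdnn (2 ^ d)))) E dvdn_exp2l.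
have c0 : (0 < c)%N by case: c Dc => //; lia.
have p0 : (0 < 2 ^ d)%N by rewrite expn_gt0.
have E2 : (c + a + d = 2 ^ (k.+1 - d))%N.
  apply/eqP; rewrite -(eqn_pmul2r p0) -expnD subnK // -E.
  by rewrite !mulnDl -Dc addnA.
have d2 : (d < 2 ^ d)%N by apply: ltn_expl.
have le1 : (2 ^ a.-1 <= 2 ^ (k.+1 - d))%N by rewrite leq_exp2l //; lia.
(* As c >= 1 and 2^d >= d + 1, a = c 2^d >= c + d, so 2^(a-1) <= c + a + d <= 2a. *)
have a4 : (a <= 4)%N by apply: expn_pred_le_double; nia.
have d3 : (d < 4)%N by nia.
(* Since 2^d divides a <= 4, only (a,d) = (2,1), (4,1), (4,2) remain. The first gives 2^(k+1) = 8;
   the other two would need 8 <= c + a + d = 7. *)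
case: d d0 d3 adk E dk Dc p0 E2 d2 le1 => [|[|[|[|d]]]] // _ _
  adk E dk Dc _ E2 _ le1.
- have [a2|a4'] : a = 2 \/ a = 4 by lia.
    have : (2 ^ k.+1 = 2 ^ 3)%N by rewrite -E a2.
    by move/eqP; rewrite eqn_exp2l // => /eqP[].
  have cE : c = 2 by lia.
  by move: le1; rewrite -E2 a4' cE.
- have aE : a = 4 by lia.
  have cE : c = 1 by lia.
  by move: le1; rewrite -E2 aE cE.
by lia.
Qed.

Theorem theorem2 :
  (forall k : nat, (3 <= k)%N ->
     ~ exists n m t : int,
       [/\ 2 <= m < n,
           n = t + 2,
           gfib k n + gfib k m = 2 ^ t
         & (n \in `[2, k%:Z + 1] /\ m \in `[2, k%:Z + 1]) \/
           (n \in `[k%:Z + 2, 2 * k%:Z + 2] /\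
            m \in `[k%:Z + 2, 2 * k%:Z + 2])])
  /\
  (forall s k : nat, (1 <= s)%N -> (2 <= k)%N ->
     2 ^+ s + s%:Z - 2 <= k%:Z ->
     let n : int := 2 ^+ s + k%:Z in
     let m : int := 2 ^+ s + s%:Z - 1 in
     let t : int := 2 ^+ s + k%:Z - 2 in
     [/\ gfib k n + gfib k m = 2 ^ t,
         2 <= m <= k%:Z + 1,
         k%:Z + 2 <= n <= 2 * k%:Z + 2
       & n = t + 2]).
Proof.
split=> [k k3 [n [m [t [mn nt E [[]|[]]]]]]|s k s1 k2 sk n m t].
- rewrite !in_itv /= => nI mI.
  have k2 : (2 <= k)%N by lia.
  have [i Di] : exists i : nat, t = i%:Z by exists `|t|%N; lia.
  have [j Dj] : exists j : nat, m = j%:Z + 2 by exists `|(m - 2)%R|%N; lia.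
  move: E; rewrite nt Di Dj !gfib_first //; try lia.
  (* Cancelling F_n = 2^t leaves F_m = 2^j = 0. *)
  rewrite -exprnP => /(congr1 (fun x => x - 2 ^+ i)); rewrite addrC addKr subrr.
  by move/eqP; rewrite expf_eq0 andbF.
- rewrite !in_itv /= => nI mI.
  have k2 : (2 <= k)%N by lia.
  have [i Di] : exists i : nat, m = k%:Z + 2 + i%:Z.
    by exists `|(m - k%:Z - 2)%R|%N; lia.
  have [d Dd] : exists d : nat, n = k%:Z + 2 + (i + d)%N%:Z.
    by exists `|(n - m)%R|%N; lia.
  have Dt : t = (k + (i + d))%N%:Z by lia.
  move/(congr1 (fun x => 2 * x)): E.
  rewrite mulrDr Dd Di Dt !gfib_second //; try lia.
  rewrite -exprnP -exprS => E.
  (* The leading power of F_n cancels 2^t; dividing the rest by 2^i gives the equation with a = i +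
     2. *)
  have /pow2_eq_add_mul : (i.+2 + (i.+2 + d) * 2 ^ d = 2 ^ k.+1)%N.
    have p0 : (0 < 2 ^ i)%N by rewrite expn_gt0.
    apply/eqP; rewrite -(eqn_pmul2l p0).
    by move: E; rewrite -!natrX !natz !expnS !expnD; lia.
  by lia.
have s2 : (s < 2 ^ s)%N by apply: ltn_expl.
have pE : 2 ^+ s = (2 ^ s)%N%:Z :> int by rewrite -natrX natz.
rewrite /n /m /t pE in sk *.
split; try lia.
set N := (2 ^ s)%N in s2 pE sk *.
have -> : N%:Z + k%:Z = k%:Z + 2 + (N - 2)%N%:Z by lia.
have -> : N%:Z + s%:Z - 1 = (N + s - 3)%N%:Z + 2 by lia.
have -> : k%:Z + 2 + (N - 2)%N%:Z - 2 = (k + (N - 2))%N%:Z by lia.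
apply: (@mulfI _ 2) => //; rewrite mulrDr gfib_second //; try lia.
rewrite gfib_first //; try lia.
(* For i = 2^s - 2 the factor i + 2 is itself a power of 2, so the correction 2^(s+i) in 2 F_n is
   exactly 2 F_m. *)
have -> : (N - 2)%N%:Z + 2 = 2 ^+ s by lia.
rewrite -exprnP -exprD -!exprS.
have -> : (s + (N - 2) = (N + s - 3).+1)%N by lia.
by rewrite subrK.
Qed.
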